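(* Given an equation $\varepsilon$ in intentional form, the maps $\varphi\mapsto{\trianglelefteq_\varphi}$ and ${\trianglelefteq}\mapsto\varphi_\trianglelefteq$ are mutually inverse bijections between compatible surjections for $\varepsilon$ and compatible preorders for $\varepsilon$.
   Context: Write $x^{(0)}=x$, $x^{(m)}=x^{\ell^m}$, $x^{(-m)}=x^{r^m}$ for $m\in\mathbb{Z}^+$. $\varepsilon$ is $1\leq w_1\vee\cdots\vee w_k$ over $x_1,\ldots,x_n$, each $w_j$ a product of terms $x_i^{(m)}$. Terms are in the intentional language expanded by constants $+$ and $-$. $FS_\varepsilon$ is the set of final subwords of the $w_j$ (including $1$); for a variable $x$, $m\in\mathbb{N}$, $v\in FS_\varepsilon$: $\Delta^v_{x,m}=\{v\}\cup\bigcup_{j=0}^m\{\sigma_jx^{(j)}\cdots\sigma_mx^{(m)}v:\sigma_j,\ldots,\sigma_m\in\{-1,0\},\sigma_0=0\}$, $\Delta^v_{x,-m}=\{v\}\cup\bigcup_{j=0}^m\{\sigma_jx^{(-j)}\cdots\sigma_mx^{(-m)}v:\sigma_j,\ldots,\sigma_m\in\{1,0\},\sigma_0=0\}$ ($\sigma=-1$: factor $-$; $\sigma=1$: factor $+$; $\sigma=0$: none); $S_\varepsilon=\{(i,m,v):v,x_i^{(m)}v\in FS_\varepsilon\}$; $\Delta_\varepsilon=\{1\}\cup\bigcup_{(i,m,v)\in S_\varepsilon}\Delta^v_{x_i,m}$ (finite). For a finite c-chain $(\Delta,\leq,\lessdot)$ ($\lessdot$ a subset of the covering relation) and an order-preserving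 partial function $g$: $(x,b)\in g^{[\ell]}$ iff $b\in Dom(g)$ and some $a\in Dom(g)$ has $a\lessdot b$, $g(a)<x\leq g(b)$; $(x,a)\in g^{[r]}$ iff $a\in Dom(g)$ and some $b\in Dom(g)$ has $a\lessdot b$, $g(a)\leq x<g(b)$; $g^{[m]}$ are the iterates ($g^{[0]}=g$, $g^{[k+1]}=(g^{[k]})^{[\ell]}$, $g^{[-(k+1)]}=(g^{[-k]})^{[r]}$). A compatible surjection for $\varepsilon$ is an onto map $\varphi:\Delta_\varepsilon\to\mathbb{N}_q=\{1,\ldots,q\}$ with: (i) each $g_i=\{(\varphi(u),\varphi(x_iu)):u,x_iu\in\Delta_\varepsilon\}$ is an order-preserving partial function; (ii) $\lessdot:=\{(\varphi(v),\varphi(+v)):v,+v\in\Delta_\varepsilon\}\cup\{(\varphi(-v),\varphi(v)):v,-v\in\Delta_\varepsilon\}$ is contained in the covering relation of $\mathbb{N}_q$; (iii) $\varphi(x_i^{(m)}u)=g_i^{[m]}(\varphi(u))$ whenever $u,x_i^{(m)}u\in\Delta_\varepsilon$, computed in $(\mathbb{N}_q,\leq,\lessdot)$. A compatible preorder is a total preorder $\trianglelefteq$ on $\Delta_\varepsilon$ ($u\triangleleft v$ meaning $u\trianglelefteq v$ and $v\not\trianglelefteq u$) such that: (i) if $u,v,x_iu,x_iv\in\Delta_\varepsilon$ and $u\trianglelefteq v$ then $x_iu\trianglelefteq x_iv$; (ii) if $u,-u\in\Delta_\varepsilon$ then $-u\triangleleft u$ and for all $v\in\Delta_\varepsilon$,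 $-u\triangleleft v$ implies $u\trianglelefteq v$; if $u,+u\in\Delta_\varepsilon$ then $u\triangleleft +u$ and for all $v$, $u\triangleleft v$ implies $+u\trianglelefteq v$; (iii$\ell$) if $j\in\mathbb{Z}^+$ and $v,x_i^{(j)}v\in\Delta_\varepsilon$ then $-x_i^{(j)}v$, $x_i^{(j-1)}{-}x_i^{(j)}v$, $x_i^{(j-1)}x_i^{(j)}v\in\Delta_\varepsilon$ and $x_i^{(j-1)}{-}x_i^{(j)}v\triangleleft v\trianglelefteq x_i^{(j-1)}x_i^{(j)}v$; (iii$r$) if $j\in\mathbb{Z}^-$ and $v,x_i^{(j)}v\in\Delta_\varepsilon$ then $+x_i^{(j)}v$, $x_i^{(j+1)}{+}x_i^{(j)}v$, $x_i^{(j+1)}x_i^{(j)}v\in\Delta_\varepsilon$ and $x_i^{(j+1)}x_i^{(j)}v\trianglelefteq v\triangleleft x_i^{(j+1)}{+}x_i^{(j)}v$. For an onto map $\varphi$ from $\Delta_\varepsilon$ to an initial segment of $\mathbb{Z}^+$, $u\trianglelefteq_\varphi v$ iff $\varphi(u)\leq\varphi(v)$. For a total preorder $\trianglelefteq$, $\varphi_\trianglelefteq$ is the quotient map of $\Delta_\varepsilon$ by ${\equiv}={\trianglelefteq}\cap{\trianglelefteq}^{-1}$ followed by the unique isomorphism of the finite chain $(\Delta_\varepsilon/{\equiv},\trianglelefteq_\equiv)$ with an initial segment $\mathbb{N}_q$ of $\mathbb{Z}^+$. *)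

(* Defs.v *)
From HB Require Import structures.
From mathcomp Require Import all_boot all_order all_algebra.

Set Implicit Arguments.
Unset Strict Implicit.
Unset Printing Implicit Defensive.

(* [X i m] is x_i^{(m)}: x_i followed by m left inverses if m >= 0, by -m right
   inverses if m < 0.  Products of letters are lists; 1 is the empty list. *)
Inductive letter (n : nat) : Type :=
  | X of 'I_n & int
  | Plus
  | Minus.
Arguments Plus {n}.
Arguments Minus {n}.

Definition letter_code n (a : letter n) : ('I_n * int) + bool :=
  match a with X i m => inl (i, m) | Plus => inr true | Minus => inr false end.
Definition letter_decode n (c : ('I_n * int) + bool) : letter n :=
  match c with
  | inl p => X p.1 p.2 | inr true => Plus | inr false => Minus
  end.
Lemma letter_codeK n : cancel (@letter_code n) (@letter_decode n).
Proof. by case. Qed.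
HB.instance Definition _ n := Countable.copy (letter n) (can_type (@letter_codeK n)).

Definition word (n : nat) := seq (letter n).

(* The equation 1 <= w_1 \/ ... \/ w_k is given by its joinands w_1, ..., w_k,
   the pair (i, m) standing for the factor x_i^{(m)}. *)
Definition equation (n k : nat) := k.-tuple (seq ('I_n * int)).

Definition to_word n (w : seq ('I_n * int)) : word n :=
  [seq X p.1 p.2 | p <- w].

Definition final_subwords (T : Type) (w : seq T) : seq (seq T) :=
  [seq drop j w | j <- iota 0 (size w).+1].

Definition FS n k (eps : equation n k) : seq (seq ('I_n * int)) :=
  [::] :: flatten [seq final_subwords w | w <- eps].

(* The candidates (i, m) may be limited to the factors occurring in eps: no
   other x_i^{(m)} v is a final subword. *)
Definition S_eps n k (eps : equation n k) : seq ('I_n * int * seq ('I_n * int)) :=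
  [seq pv <- [seq (p, v) | p <- flatten eps, v <- FS eps] | pv.1 :: pv.2 \in FS eps].

(* sigma_j x^{(e j)} ... sigma_m x^{(e m)} v, where the t-th entry of s tells
   whether sigma_t is the constant c or absent. *)
Definition sigma_word n (c : letter n) (i : 'I_n) (e : nat -> int) (v : word n)
    (m j : nat) (s : seq bool) : word n :=
  flatten [seq (if nth false s t then [:: c] else [::]) ++ [:: X i (e t)]
          | t <- iota j (m.+1 - j)] ++ v.

Definition sigma_words n (c : letter n) (i : 'I_n) (e : nat -> int) (v : word n)
    (m : nat) : seq (word n) :=
  [seq sigma_word c i e v m j s
  | j <- iota 0 m.+1, s : m.+1.-tuple bool <- enum [pred s : m.+1.-tuple bool | ~~ nth false s 0]].

Definition Delta_vxm n (v : word n) (i : 'I_n) (m : int) : seq (word n) :=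
  v :: match m with
       | Posz p => sigma_words Minus i (fun t => t%:Z)%R v p
       | Negz p => sigma_words Plus i (fun t => - t%:Z)%R v p.+1
       end.

Definition Delta_seq n k (eps : equation n k) : seq (word n) :=
  [::] :: flatten [seq Delta_vxm (to_word pv.2) pv.1.1 pv.1.2 | pv <- S_eps eps].

Definition Delta n k (eps : equation n k) : finType := seq_sub (Delta_seq eps).

(* c-chains: the chain is a subset D of a totally ordered type T, and partial
   functions on it are represented by their graphs, [g x y] meaning g(x) = y. *)
Section CChain.
Variables (d : Order.disp_t) (T : orderType d) (D : {pred T}).
Local Open Scope order_scope.
Implicit Types (prec g : T -> T -> Prop).

Definition covering (a b : T) : Prop :=
  [/\ a \in D, b \in D, a < b & forall z, z \in D -> ~ (a < z < b)].

Definition order_preserving_pfun g : Prop :=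
  (forall x y, g x y -> x \in D /\ y \in D) /\
  (forall x y y', g x y -> g x y' -> y = y') /\
  (forall x x' y y', g x y -> g x' y' -> x <= x' -> y <= y').

Definition lres prec g (x b : T) : Prop :=
  x \in D /\
  exists a ga gb, [/\ g a ga, g b gb, prec a b & ga < x <= gb].

Definition rres prec g (x a : T) : Prop :=
  x \in D /\
  exists b ga gb, [/\ g a ga, g b gb, prec a b & ga <= x < gb].

Definition res_iter prec g (m : int) : T -> T -> Prop :=
  match m with
  | Posz p => iter p (lres prec) g
  | Negz p => iter p.+1 (rres prec) g
  end.

End CChain.

Definition NN (q : nat) : {pred nat} := [pred y | 1 <= y <= q].

Section Compatible.
Variables (n k : nat) (eps : equation n k).
Local Notation Delta := (Delta eps).
Implicit Types (phi : {ffun Delta -> nat}) (R : {set Delta * Delta}).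

Definition g_of phi (i : 'I_n) (x y : nat) : Prop :=
  exists u xu : Delta, [/\ val xu = X i 0 :: val u, x = phi u & y = phi xu].

Definition prec_of phi (a b : nat) : Prop :=
  (exists v pv : Delta, [/\ val pv = Plus :: val v, a = phi v & b = phi pv]) \/
  (exists v mv : Delta, [/\ val mv = Minus :: val v, a = phi mv & b = phi v]).

(* A map onto NN q is a nat-valued map with range NN q, which determines q. *)
Definition onto_NN phi (q : nat) : Prop :=
  forall y, y \in NN q <-> exists u, phi u = y.

Definition compatible_surjection phi : Prop :=
  exists q : nat,
    [/\ onto_NN phi q,
        forall i, order_preserving_pfun (NN q) (g_of phi i),
        forall a b, prec_of phi a b -> covering (NN q) a b
      & forall i m (u xu : Delta), val xu = X i m :: val u ->
          res_iter (NN q) (prec_of phi) (g_of phi i) m (phi u) (phi xu)].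

Definition ple R (u v : Delta) : bool := (u, v) \in R.
Definition plt R (u v : Delta) : bool := ple R u v && ~~ ple R v u.

Definition total_preorder R : Prop :=
  [/\ reflexive (ple R), transitive (ple R) & total (ple R)].

Definition compatible_preorder R : Prop :=
  total_preorder R /\
  [/\ forall i (u v xu xv : Delta),
        val xu = X i 0 :: val u -> val xv = X i 0 :: val v ->
        ple R u v -> ple R xu xv,
      (forall u mu : Delta, val mu = Minus :: val u ->
        plt R mu u /\ forall v, plt R mu v -> ple R u v) /\
      (forall u pu : Delta, val pu = Plus :: val u ->
        plt R u pu /\ forall v, plt R u v -> ple R pu v),
      forall i (j : int) (v xv : Delta), (0 < j)%R -> val xv = X i j :: val v ->
        exists mxv xmxv xxv : Delta,
          [/\ val mxv = Minus :: val xv,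
              val xmxv = X i (j - 1)%R :: val mxv,
              val xxv = X i (j - 1)%R :: val xv,
              plt R xmxv v & ple R v xxv]
    & forall i (j : int) (v xv : Delta), (j < 0)%R -> val xv = X i j :: val v ->
        exists pxv xpxv xxv : Delta,
          [/\ val pxv = Plus :: val xv,
              val xpxv = X i (j + 1)%R :: val pxv,
              val xxv = X i (j + 1)%R :: val xv,
              ple R xxv v & plt R v xpxv]].

Definition preorder_of phi : {set Delta * Delta} :=
  [set p | phi p.1 <= phi p.2].

Definition pequiv R (u v : Delta) : bool := ple R u v && ple R v u.

Definition class_of R (u : Delta) : {set Delta} := [set v | pequiv R u v].

Definition quotient_by R : {set {set Delta}} := [set class_of R u | u : Delta].

Definition cle R (A B : {set Delta}) : bool :=
  [exists u in A, exists v in B, ple R u v].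

Definition chain_iso R (q : nat) (f : {set Delta} -> nat) : Prop :=
  (forall y, y \in NN q <-> exists2 A, A \in quotient_by R & f A = y) /\
  {in quotient_by R &, forall A B, (f A <= f B) = cle R A B}.

(* The isomorphism of the quotient chain with NN q sends a class to its
   position; [class_rank_iso] and [chain_iso_unique] show that this is an
   isomorphism and the only one. *)
Definition class_rank R (A : {set Delta}) : nat :=
  #|[set B in quotient_by R | cle R B A]|.

Definition surjection_of R : {ffun Delta -> nat} :=
  [ffun u => class_rank R (class_of R u)].

Lemma cle_class R u v : total_preorder R ->
  cle R (class_of R u) (class_of R v) = ple R u v.
Proof.
case=> rR tR _; apply/exists_inP/idP => [[a]|uv].
  rewrite inE => /andP[ua _] /exists_inP[b]; rewrite inE => /andP[_ bv] ab.
  exact: tR (tR _ _ _ ua ab) bv.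
exists u; rewrite ?inE /pequiv ?rR //.
by apply/exists_inP; exists v; rewrite ?inE /pequiv ?rR.
Qed.

Lemma class_eq R u v : total_preorder R ->
  ple R u v -> ple R v u -> class_of R u = class_of R v.
Proof.
case=> _ tR _ uv vu; apply/setP => w; rewrite !inE /pequiv.
apply/andP/andP => -[h1 h2]; split.
- exact: tR vu h1.
- exact: tR h2 uv.
- exact: tR uv h1.
- exact: tR h2 vu.
Qed.

Lemma class_rank_le R : total_preorder R ->
  {in quotient_by R &, forall A B, (class_rank R A <= class_rank R B) = cle R A B}.
Proof.
move=> pR; have [rR tR toR] := pR.
have mono a b : ple R a b ->
    [set C in quotient_by R | cle R C (class_of R a)] \subset
    [set C in quotient_by R | cle R C (class_of R b)].
  move=> ab; apply/subsetP => C; rewrite !inE => /andP[CQ].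
  rewrite CQ; case/imsetP: CQ => c _ ->; rewrite !cle_class //.
  by move=> ca; exact: tR ca ab.
move=> A B /imsetP[a _ ->] /imsetP[b _ ->]; rewrite cle_class //.
apply/idP/idP => [|ab]; last by apply: subset_leq_card; apply: mono.
apply: contraTT => nab; have ba : ple R b a.
  by have := toR a b; rewrite (negPf nab).
rewrite -ltnNge; apply: proper_card; rewrite properE mono //=.
apply/subsetPn; exists (class_of R a); rewrite !inE !cle_class ?rR ?(negPf nab) ?andbF //.
by rewrite andbT; apply/imsetP; exists a.
Qed.

Lemma cle_anti R : total_preorder R ->
  {in quotient_by R &, forall A B, cle R A B -> cle R B A -> A = B}.
Proof.
move=> pR A B /imsetP[a _ ->] /imsetP[b _ ->]; rewrite !cle_class //.
exact: class_eq.
Qed.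

Lemma class_rank_iso R : total_preorder R ->
  chain_iso R #|quotient_by R| (class_rank R).
Proof.
move=> pR; split; last exact: class_rank_le.
set Q := quotient_by R.
have rng A : A \in Q -> class_rank R A \in NN #|Q|.
  move=> AQ; rewrite inE; apply/andP; split.
    apply/card_gt0P; exists A; rewrite inE AQ.
    by case/imsetP: AQ => a _ ->; rewrite cle_class //; case: pR => rR _ _; exact: rR.
  by apply: subset_leq_card; apply/subsetP => B; rewrite inE => /andP[].
have inj : {in Q &, injective (class_rank R)}.
  move=> A B AQ BQ e; apply: (cle_anti pR) => //;
  by rewrite -class_rank_le // e.
move=> y; split; last by case=> A AQ <-; exact: rng.
set s := [seq class_rank R A | A <- enum Q].
have us : uniq s.
  rewrite map_inj_in_uniq ?enum_uniq // => A B.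
  by rewrite !mem_enum; exact: inj.
have ss : {subset s <= iota 1 #|Q|}.
  by move=> z /mapP[A]; rewrite mem_enum => /rng h ->; rewrite mem_iota add1n ltnS.
have [//|_ es] := uniq_min_size us ss; first by rewrite size_iota size_map -cardE.
move=> yN; have : y \in s by rewrite es mem_iota add1n ltnS.
by case/mapP => A; rewrite mem_enum => AQ ->; exists A.
Qed.

Lemma chain_iso_unique R q f : total_preorder R -> chain_iso R q f ->
  q = #|quotient_by R| /\ {in quotient_by R, f =1 class_rank R}.
Proof.
move=> pR [rng mono]; set Q := quotient_by R.
have inj : {in Q &, injective f}.
  by move=> A B AQ BQ e; apply: (cle_anti pR) => //; rewrite -mono // e.
have key A : A \in Q -> f A = class_rank R A.
  move=> AQ; have fA : f A \in NN q by apply/rng; exists A.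
  pose P := [set B in Q | cle R B A].
  have eP : [seq f B | B <- enum P] =i iota 1 (f A).
    move=> y; rewrite mem_iota add1n ltnS; apply/mapP/idP.
      case=> B; rewrite mem_enum inE => /andP[BQ BA] ->.
      rewrite mono // BA andbT.
      have : f B \in NN q by apply/rng; exists B.
      by rewrite inE => /andP[].
    case/andP=> y1 yA; have : y \in NN q.
      by rewrite inE y1 (leq_trans yA) //; move: fA; rewrite inE => /andP[].
    by move/rng=> [B BQ e]; exists B; rewrite // mem_enum inE BQ -mono // e.
  have uP : uniq [seq f B | B <- enum P].
    rewrite map_inj_in_uniq ?enum_uniq // => B C.
    by rewrite !mem_enum !inE => /andP[BQ _] /andP[CQ _]; exact: inj.
  have := perm_size (uniq_perm uP (iota_uniq 1 (f A)) eP).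
  by rewrite size_map size_iota -cardE.
split=> //.
have eQ : [seq f B | B <- enum Q] =i iota 1 q.
  move=> y; rewrite mem_iota add1n ltnS; apply/mapP/idP.
    by case=> B; rewrite mem_enum => BQ ->; apply/rng; exists B.
  by move/rng=> [B BQ e]; exists B; rewrite // mem_enum.
have uQ : uniq [seq f B | B <- enum Q].
  by rewrite map_inj_in_uniq ?enum_uniq // => B C; rewrite !mem_enum; exact: inj.
have := perm_size (uniq_perm uQ (iota_uniq 1 q) eQ).
by rewrite size_map size_iota -cardE.
Qed.

End Compatible.

(* Main.v *)
(* The surjection of a preorder sends u to the rank of its class, so the two
   maps are mutually inverse because an onto map to an initial segment is
   determined by the preorder it induces.  Condition (iii) of a surjection
   unfolds one residual at a time into (iii l) and (iii r): the element covered
   by phi(x^(j) v) is unique, hence is phi(-x^(j) v), and Delta is closed under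
   the words needed to compute the residual there. *)
Require Import Defs.
From mathcomp Require Import all_boot all_order all_algebra.
From mathcomp Require Import zify.

Set Implicit Arguments.
Unset Strict Implicit.
Unset Printing Implicit Defensive.

(** * Residuals of order-preserving partial functions on a c-chain *)

Section Residuals.
Variables (d : Order.disp_t) (T : orderType d) (D : {pred T}).
Variables (prec g : T -> T -> Prop).
Hypothesis prec_covering : forall a b, prec a b -> covering D a b.
Local Open Scope order_scope.
Import Order.TTheory.

Lemma covering_unique_l a a' b : covering D a b -> covering D a' b -> a = a'.
Proof.
move=> [aD _ ab nab] [aD' _ ab' nab'].
case: (ltgtP a a') => // h.
  by case: (nab _ aD'); rewrite h ab'.
by case: (nab' _ aD); rewrite h ab.
Qed.

Lemma covering_unique_r a b b' : covering D a b -> covering D a b' -> b = b'.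
Proof.
move=> [_ bD ab nab] [_ bD' ab' nab'].
case: (ltgtP b b') => // h.
  by case: (nab' _ bD); rewrite h ab.
by case: (nab _ bD'); rewrite h ab'.
Qed.

(** Let [x <= x'] have values [b] and [b'], with [a] covered by [b] and [g(a) < x]. If [b' < b], the
    covering forces [b' <= a], so [x' <= g(b') <= g(a) < x], a contradiction. Single-valuedness is
    this monotonicity applied twice to the same argument. *)
Lemma lres_order_preserving :
  order_preserving_pfun D g -> order_preserving_pfun D (lres D prec g).
Proof.
move=> [gD [_ gM]].
have mono x x' b b' :
    lres D prec g x b -> lres D prec g x' b' -> x <= x' -> b <= b'.
  move=> [_ [a [ga [gb [aga _ ab /andP[gax _]]]]]].
  move=> [_ [_ [_ [gb' [_ bgb' _ /andP[_ xgb']]]]]] xx'.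
  rewrite leNgt; apply/negP => b'b.
  have [_ _ _ nab] := prec_covering ab.
  have b'a : b' <= a.
    rewrite leNgt; apply/negP => ab'.
    by apply: (nab b'); [case: (gD _ _ bgb') | rewrite ab' b'b].
  have := le_lt_trans (gM _ _ _ _ bgb' aga b'a) gax.
  by rewrite ltNge (le_trans xx' xgb').
split; last split.
- move=> x b [xD [a [ga [gb [_ bgb _ _]]]]]; split=> //.
  by case: (gD _ _ bgb).
- by move=> x b b' h h'; apply/le_anti/andP; split; apply: mono (lexx x).
- by move=> x x' b b'; exact: mono.
Qed.

(** Dual argument: if [a' < a] and [a'] is covered by [b'], then [b' <= a], so
    [x' < g(b') <= g(a) <= x]. *)
Lemma rres_order_preserving :
  order_preserving_pfun D g -> order_preserving_pfun D (rres D prec g).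
Proof.
move=> [gD [_ gM]].
have mono x x' a a' :
    rres D prec g x a -> rres D prec g x' a' -> x <= x' -> a <= a'.
  move=> [_ [_ [ga [_ [aga _ _ /andP[gax _]]]]]].
  move=> [_ [b' [_ [gb' [_ bgb' ab' /andP[_ xgb']]]]]] xx'.
  rewrite leNgt; apply/negP => a'a.
  have [_ _ _ nab] := prec_covering ab'.
  have b'a : b' <= a.
    rewrite leNgt; apply/negP => ab.
    by apply: (nab a); [case: (gD _ _ aga) | rewrite a'a ab].
  have := lt_le_trans xgb' (gM _ _ _ _ bgb' aga b'a).
  by rewrite ltNge (le_trans gax xx').
split; last split.
- move=> x a [xD [b [ga [gb [aga _ _ _]]]]]; split=> //.
  by case: (gD _ _ aga).
- by move=> x b b' h h'; apply/le_anti/andP; split; apply: mono (lexx x).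
- by move=> x x' b b'; exact: mono.
Qed.

End Residuals.

Lemma res_iter_order_preserving (d : Order.disp_t) (T : orderType d)
    (D : {pred T}) (prec g : T -> T -> Prop) m :
  (forall a b, prec a b -> covering D a b) ->
  order_preserving_pfun D g -> order_preserving_pfun D (res_iter D prec g m).
Proof.
move=> pc gP; case: m => p /=.
  by elim: p => //= p; exact: lres_order_preserving.
by elim: p => [|p IHp] /=; apply: rres_order_preserving.
Qed.

(** * Closure of [Delta] under the words that compute residuals *)

Section DeltaClosure.
Variable n : nat.
Implicit Types (c : letter n) (i : 'I_n) (e : nat -> int) (u v : word n).

Lemma sigma_word_last c i e v m s : sigma_word c i e v m m.+1 s = v.
Proof. by rewrite /sigma_word subnn. Qed.

Lemma sigma_word_step c i e v m j s : j <= m ->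
  sigma_word c i e v m j s =
  (if nth false s j then [:: c] else [::])
    ++ X i (e j) :: sigma_word c i e v m j.+1 s.
Proof. by move=> jm; rewrite /sigma_word subSn //= subSS -!catA. Qed.

Lemma eq_sigma_word c i e v m j s s' :
  (forall t, j <= t -> nth false s t = nth false s' t) ->
  sigma_word c i e v m j s = sigma_word c i e v m j s'.
Proof.
move=> ss'; congr (flatten _ ++ _); apply/eq_in_map => t.
by rewrite mem_iota => /andP[/ss' ->].
Qed.

Lemma sigma_wordsP c i e v m (w : word n) :
  reflect (exists j s, [/\ j <= m, size s = m.+1, nth false s 0 = false
                         & w = sigma_word c i e v m j s])
          (w \in sigma_words c i e v m).
Proof.
apply: (iffP allpairsP) => [[[j s] /= [jm s0 ->]]|[j [s [jm sm s0 ->]]]].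
  exists j, s; rewrite size_tuple; split=> //.
    by move: jm; rewrite (mem_iota 0 m.+1).
  by move: s0; rewrite mem_enum inE => /negbTE.
have ts : size s == m.+1 by rewrite sm.
exists (j, Tuple ts) => /=; split=> //; first by rewrite (mem_iota 0 m.+1).
by rewrite mem_enum inE s0.
Qed.

Lemma sigma_words_cons c i e v m : X i (e m) :: v \in sigma_words c i e v m.
Proof.
apply/sigma_wordsP; exists m, (nseq m.+1 false); split=> //.
  by rewrite size_nseq.
by rewrite sigma_word_step // sigma_word_last nth_nseq ltnSn.
Qed.

(** A word of the family that starts with a variable has index [j] and no sign at [j]. When [j > 0],
    switching on the sign at [j], prefixing the unsigned letter of index [j.-1], or doing both,
    stays in the family. The hypothesis on [c] keeps signs apart from variables. *)
Lemma sigma_words_closed c i e v m i' z u :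
  (forall y t, c <> X y t) -> X i' z :: u \in sigma_words c i e v m ->
  i' = i /\ exists2 j, z = e j & 0 < j ->
    [/\ c :: X i z :: u \in sigma_words c i e v m,
        X i (e j.-1) :: c :: X i z :: u \in sigma_words c i e v m
      & X i (e j.-1) :: X i z :: u \in sigma_words c i e v m].
Proof.
move=> cX /sigma_wordsP[j [s [jm sm s0]]].
rewrite sigma_word_step //; case sj : (nth false s j) => /=.
  by case=> eX; case: (cX i' z).
case=> -> -> eu; split=> //; exists j => // j0; subst u.
have j1m : j.-1 <= m by lia.
(* The modified signs: [b] at [j], none at [j.-1], those of [s] elsewhere. Position 0 remains
   unsigned because [0 < j]. *)
pose f b := mkseq (fun t => if t == j then b else
                            if t == j.-1 then false else nth false s t) m.+1.
have fE b t : nth false (f b) t = if t == j then b else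
                            if t == j.-1 then false else nth false s t.
  case: (ltnP t m.+1) => tm; first by rewrite nth_mkseq.
  rewrite nth_default ?size_mkseq // ifF; last by lia.
  by rewrite ifF ?nth_default ?sm //; lia.
have f0 b : nth false (f b) 0 = false.
  by rewrite fE s0 if_same ifF //; lia.
have fS b : sigma_word c i e v m j.+1 (f b) = sigma_word c i e v m j.+1 s.
  by apply: eq_sigma_word => t jt; rewrite fE !ifF //; lia.
have fj b : sigma_word c i e v m j (f b) =
    (if b then [:: c] else [::]) ++ X i (e j) :: sigma_word c i e v m j.+1 s.
  by rewrite sigma_word_step // fE eqxx fS.
have fj1 b : sigma_word c i e v m j.-1 (f b) =
    X i (e j.-1) :: sigma_word c i e v m j (f b).
  have jj : (j.-1 == j) = false by lia.
  by rewrite sigma_word_step // fE eqxx jj prednK.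
split; apply/sigma_wordsP.
- by exists j, (f true); rewrite size_mkseq f0 fj.
- by exists j.-1, (f true); rewrite size_mkseq f0 fj1 fj.
- by exists j.-1, (f false); rewrite size_mkseq f0 fj1 fj.
Qed.

Variables (k : nat) (eps : equation n k).

Lemma FSP (w : seq ('I_n * int)) :
  reflect (w = [::] \/ exists2 w', w' \in eps & exists j, w = drop j w')
          (w \in FS eps).
Proof.
rewrite inE; apply: (iffP orP) => [[/eqP|/flatten_mapP[w' w'E]]|].
- by left.
- by case/mapP => j _ ->; right; exists w' => //; exists j.
case=> [->|[w' w'E [j ->]]]; first by left.
right; apply/flatten_mapP; exists w' => //; apply/mapP.
(* Indices past the end all give the empty word, already reached at [size w']. *)
case: (leqP j (size w')) => jw; first by exists j => //; rewrite mem_iota.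
exists (size w'); first by rewrite mem_iota add0n leqnn.
by rewrite drop_size drop_oversize // ltnW.
Qed.

Lemma FS_cons p w : p :: w \in FS eps -> (p, w) \in S_eps eps.
Proof.
move=> pw; rewrite mem_filter; apply/andP; split=> //; case/FSP: pw => // -[w' w'E [j e]].
apply/allpairsP; exists (p, w); split=> //=.
  apply/flattenP; exists w' => //; apply: (@mem_drop j).
  by rewrite -e mem_head.
apply/FSP; right; exists w' => //; exists j.+1.
by rewrite -add1n -drop_drop -e /= drop0.
Qed.

Lemma mem_Delta p w u : (p, w) \in S_eps eps ->
  u \in behead (Delta_vxm (to_word w) p.1 p.2) -> u \in Delta_seq eps.
Proof.
move=> pw /mem_behead uD; rewrite inE; apply/orP; right.
by apply/flatten_mapP; exists (p, w).
Qed.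

(** [behead] discards the base word [v] of each set. If the given word is itself such a [v], it is a
    nonempty final subword, so its first factor and its tail form a triple of [S_eps] whose own
    family contains it. *)
Lemma Delta_X i z u : X i z :: u \in Delta_seq eps ->
  exists p w, (p, w) \in S_eps eps /\
    X i z :: u \in behead (Delta_vxm (to_word w) p.1 p.2).
Proof.
rewrite inE /= => /flatten_mapP[[p w] pw].
rewrite inE => /orP[/eqP e|h]; last by exists p, w.
case: w e pw => // p' w [-> -> ->]; rewrite mem_filter => /andP[_].
case/allpairsP => -[a b] [_ /= bF [_ e]]; subst b.
exists p', w; split; first exact: FS_cons.
by case: p' {bF} => y [] t /=; [| rewrite NegzE]; apply: sigma_words_cons.
Qed.

Lemma Delta_closed_l i (z : int) u : (0 < z)%R ->
  X i z :: u \in Delta_seq eps ->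
  [/\ Minus :: X i z :: u \in Delta_seq eps,
      X i (z - 1)%R :: Minus :: X i z :: u \in Delta_seq eps
    & X i (z - 1)%R :: X i z :: u \in Delta_seq eps].
Proof.
move=> z0 /Delta_X[[y t] [w [pw /=]]].
have := mem_Delta pw; case: t {pw} => t /= sub.
  case/sigma_words_closed => // -> [j zj cl].
  have j0 : 0 < j by lia.
  have <- : (j.-1)%:Z%R = (z - 1)%R by lia.
  by case: (cl j0) => h1 h2 h3; split; apply: sub.
(* The exponents of a [Plus] family are at most 0, against [0 < z]. *)
by case/sigma_words_closed => // _ [j zj _]; lia.
Qed.

Lemma Delta_closed_r i (z : int) u : (z < 0)%R ->
  X i z :: u \in Delta_seq eps ->
  [/\ Plus :: X i z :: u \in Delta_seq eps,
      X i (z + 1)%R :: Plus :: X i z :: u \in Delta_seq eps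
    & X i (z + 1)%R :: X i z :: u \in Delta_seq eps].
Proof.
move=> z0 /Delta_X[[y t] [w [pw /=]]].
have := mem_Delta pw; case: t {pw} => t /= sub.
  by case/sigma_words_closed => // _ [j zj _]; lia.
case/sigma_words_closed => // -> [j zj cl].
have j0 : 0 < j by lia.
have <- : (- (j.-1)%:Z)%R = (z + 1)%R by lia.
by case: (cl j0) => h1 h2 h3; split; apply: sub.
Qed.

End DeltaClosure.

(** * The two maps between surjections and preorders *)

Section Correspondence.
Variables (n k : nat) (eps : equation n k).
Implicit Types (phi : {ffun Delta eps -> nat}) (R : {set Delta eps * Delta eps}).

Lemma ple_preorder_of phi u v : ple (preorder_of phi) u v = (phi u <= phi v).
Proof. by rewrite /ple inE. Qed.

Lemma plt_preorder_of phi u v : plt (preorder_of phi) u v = (phi u < phi v).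
Proof. by rewrite /plt !ple_preorder_of; lia. Qed.

Lemma preorder_of_total phi : total_preorder (preorder_of phi).
Proof.
split=> [u|v u w|u v]; rewrite !ple_preorder_of //; first exact: leq_trans.
exact: leq_total.
Qed.

Lemma ple_surjection_of R u v : total_preorder R ->
  (surjection_of R u <= surjection_of R v) = ple R u v.
Proof.
by move=> pR; rewrite !ffunE class_rank_le ?cle_class // imset_f.
Qed.

Lemma preorder_ofK R : total_preorder R -> preorder_of (surjection_of R) = R.
Proof. by move=> pR; apply/setP => -[u v]; rewrite inE ple_surjection_of. Qed.

(** [phi] factors through the quotient as an isomorphism onto [NN q], and such an isomorphism can
    only be the rank. *)
Lemma surjection_ofK phi q : onto_NN phi q ->
  surjection_of (preorder_of phi) = phi.
Proof.
move=> onto; have pR := preorder_of_total phi.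
(* The induced map on classes; the value 0 is taken only on the empty set, which is not a class. *)
pose f (A : {set Delta eps}) := if [pick u in A] is Some u then phi u else 0.
have fE u : f (class_of (preorder_of phi) u) = phi u.
  rewrite /f; case: pickP => [v|/(_ u)].
    by rewrite inE /pequiv !ple_preorder_of => /anti_leq.
  by rewrite inE /pequiv ple_preorder_of leqnn.
have [||_ fr] := @chain_iso_unique _ _ eps (preorder_of phi) q f => //.
  split=> [y|A B /imsetP[a _ ->] /imsetP[b _ ->]].
    split=> [/onto[u <-]|[A /imsetP[u _ ->] <-]].
      by exists (class_of (preorder_of phi) u); rewrite ?fE // imset_f.
    by rewrite fE; apply/onto; exists u.
  by rewrite !fE cle_class // ple_preorder_of.
by apply/ffunP => u; rewrite ffunE -fr ?fE // imset_f.
Qed.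

Lemma surjection_of_onto R : total_preorder R ->
  onto_NN (surjection_of R) #|quotient_by R|.
Proof.
move=> pR y; have [rng _] := class_rank_iso pR; split.
  by move/rng=> [A /imsetP[u _ ->] <-]; exists u; rewrite ffunE.
by case=> u <-; apply/rng; exists (class_of R u); rewrite ?ffunE // imset_f.
Qed.

Lemma compatible_preorder_of phi :
  compatible_surjection phi -> compatible_preorder (preorder_of phi).
Proof.
case=> q [onto gP pc gi].
have phiN u : phi u \in NN q by apply/onto; exists u.
have pcM u mu (e : val mu = Minus :: val u) : prec_of phi (phi mu) (phi u).
  by right; exists u, mu.
have pcP u pu (e : val pu = Plus :: val u) : prec_of phi (phi u) (phi pu).
  by left; exists u, pu.
(* Each iterated residual is single-valued; this later identifies the values at the covering pair
   with values of [phi]. *)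
have gF i m := (res_iter_order_preserving m pc (gP i)).2.1.
split; first exact: preorder_of_total.
split.
- move=> i u v xu xv exu exv; rewrite !ple_preorder_of.
  by apply: (gP i).2.2; [exists u, xu | exists v, xv].
(* In both sign cases, an element violating the second half of the clause would have its [phi] value
   strictly inside a covering pair. *)
- split=> u u'.
    move/pcM/pc => [_ _ lt nlt]; split=> [|v].
      by rewrite plt_preorder_of.
    rewrite plt_preorder_of ple_preorder_of => uv.
    by rewrite leqNgt; apply/negP => vu; case: (nlt _ (phiN v)); apply/andP.
  move/pcP/pc => [_ _ lt nlt]; split=> [|v].
    by rewrite plt_preorder_of.
  rewrite plt_preorder_of ple_preorder_of => uv.
  by rewrite leqNgt; apply/negP => vu; case: (nlt _ (phiN v)); apply/andP.
- move=> i j v xv j0 exv.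
  have := valP xv; rewrite exv => /(Delta_closed_l j0)[].
  rewrite -exv => h1 h2 h3.
  pose mxv : Delta eps := SeqSub h1.
  pose xmxv : Delta eps := SeqSub h2.
  pose xxv : Delta eps := SeqSub h3.
  exists mxv, xmxv, xxv; rewrite plt_preorder_of ple_preorder_of.
  have rv := gi i j _ _ exv.
  have g1 := gi i (j - 1)%R mxv xmxv erefl.
  have g2 := gi i (j - 1)%R xv xxv erefl.
  have [p ej] : exists p : nat, j = p.+1%:Z%R by exists `|j - 1|%N; lia.
  have ej1 : (j - 1)%R = p%:Z%R by lia.
  rewrite ej1 in g1 g2; rewrite ej in rv; case: rv => _ [a [ga [gb [aga bgb ab]]]].
  (* The witness [a] of the left residual is the only element covered by [phi xv], hence equals
     [phi mxv]; the inequalities of the residual then become those of the clause. *)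
  have ea := covering_unique_l (pc _ _ ab) (pc _ _ (pcM xv mxv erefl)).
  rewrite ea in aga.
  rewrite (gF i p%:Z%R _ _ _ aga g1) (gF i p%:Z%R _ _ _ bgb g2).
  by case/andP=> ? ?; split.
- move=> i j v xv j0 exv.
  have := valP xv; rewrite exv => /(Delta_closed_r j0)[].
  rewrite -exv => h1 h2 h3.
  pose pxv : Delta eps := SeqSub h1.
  pose xpxv : Delta eps := SeqSub h2.
  pose xxv : Delta eps := SeqSub h3.
  exists pxv, xpxv, xxv; rewrite plt_preorder_of ple_preorder_of.
  have := gi i j _ _ exv.
  have g1 := gi i (j + 1)%R pxv xpxv erefl.
  have g2 := gi i (j + 1)%R xv xxv erefl.
  case: j j0 exv h1 h2 h3 @pxv @xpxv @xxv g1 g2 => // p _ exv h1 h2 h3 pxv xpxv xxv.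
  move=> g1 g2 rv.
  (* Peels off one right residual. The cases on [p] are needed because for [p = 0] the inner iterate
     is [g] itself, indexed by a [Posz], and otherwise it is indexed by a [Negz]. *)
  have {rv} [_ [b [ga [gb [aga bgb ab]]]]] :
    rres (NN q) (prec_of phi)
      (res_iter (NN q) (prec_of phi) (g_of phi i) (Negz p + 1)%R) (phi v) (phi xv).
    by case: p {exv h1 h2 h3 pxv xpxv xxv g1 g2} rv => [|p] //; rewrite /= ?subn1.
  have eb := covering_unique_r (pc _ _ ab) (pc _ _ (pcP xv pxv erefl)).
  rewrite eb in bgb.
  by rewrite (gF i _ _ _ _ aga g2) (gF i _ _ _ _ bgb g1); case/andP=> ? ?; split.
Qed.

(** Since [phi] reflects [R], clauses (i) and (ii) transfer directly. The residual condition is an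
    induction on the order of the residual, with the words of clause (iii) as witnesses. *)
Lemma compatible_surjection_of R :
  compatible_preorder R -> compatible_surjection (surjection_of R).
Proof.
case=> pR [R1 [RM RP] Rl Rr]; set phi := surjection_of R.
have leE u v : (phi u <= phi v) = ple R u v by exact: ple_surjection_of.
have ltE u v : (phi u < phi v) = plt R u v.
  by rewrite /plt -!leE; lia.
have onto : onto_NN phi #|quotient_by R| by exact: surjection_of_onto.
have phiN u : phi u \in NN #|quotient_by R| by apply/onto; exists u.
have mono i u v xu xv : val xu = X i 0 :: val u -> val xv = X i 0 :: val v ->
    phi u <= phi v -> phi xu <= phi xv.
  by move=> eu ev; rewrite !leE; exact: R1 eu ev.
exists #|quotient_by R|; split=> //.
- move=> i; split=> [x y [u [xu [_ -> ->]]]|]; first by split; exact: phiN.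
  split.
    (* Words with equal [phi] values are equivalent, so monotonicity in both directions gives equal
       images. *)
    move=> x y y' [u [xu [eu -> ->]]] [v [xv [ev uv ->]]].
    by apply/eqP; rewrite eqn_leq (mono _ _ _ _ _ eu ev) ?(mono _ _ _ _ _ ev eu) ?uv.
  by move=> x x' y y' [u [xu [eu -> ->]]] [v [xv [ev -> ->]]]; exact: mono eu ev.
(* Any [z] in the range is some [phi w], and clause (ii) rules out a [w] strictly between a word and
   its signed version. *)
- move=> a b [[v [v' [/RP[lt nlt] -> ->]]]|[v [v' [/RM[lt nlt] -> ->]]]];
  split; rewrite ?ltEnat /= ?ltE // => z /onto[w <-] /andP[];
  by rewrite ltE => /nlt; rewrite -leE leqNgt => /negP.
- move=> i m; case: m.
    elim=> [|p IHp] u xu exu; first by exists u, xu.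
    have [//|mxu [xmxu [xxu [e1 e2 e3 h1 h2]]]] := Rl i p.+1%:Z%R u xu _ exu.
    have ep : (p.+1%:Z - 1)%R = p by lia.
    rewrite ep in e2 e3.
    split; first exact: phiN.
    exists (phi mxu), (phi xmxu), (phi xxu); split.
    + exact: IHp.
    + exact: IHp.
    + by right; exists xu, mxu.
    + by rewrite ltEnat leEnat /= ltE leE h1.
  (* The negative side starts at exponent -1: there the inner function is [g] itself, so the words
     of clause (iii) give its values without an induction hypothesis. *)
  elim=> [|p IHp] u xu exu.
    have [//|pxu [xpxu [xxu [e1 e2 e3 h1 h2]]]] := Rr i (Negz 0) u xu _ exu.
    split; first exact: phiN.
    exists (phi pxu), (phi xxu), (phi xpxu); split.
    + by exists xu, xxu.
    + by exists pxu, xpxu.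
    + by left; exists xu, pxu.
    + by rewrite ltEnat leEnat /= ltE leE h1.
  have [//|pxu [xpxu [xxu [e1 e2 e3 h1 h2]]]] := Rr i (Negz p.+1) u xu _ exu.
  have ep : (Negz p.+1 + 1)%R = Negz p by lia.
  rewrite ep in e2 e3.
  split; first exact: phiN.
  exists (phi pxu), (phi xxu), (phi xpxu); split.
  + exact: IHp.
  + exact: IHp.
  + by left; exists xu, pxu.
  + by rewrite ltEnat leEnat /= ltE leE h1.
Qed.

End Correspondence.

Theorem theorem5p1 (n k : nat) (k_gt0 : 0 < k) (eps : equation n k) :
  [/\ forall phi : {ffun Delta eps -> nat},
        compatible_surjection phi -> compatible_preorder (preorder_of phi),
      forall R : {set Delta eps * Delta eps},
        compatible_preorder R -> compatible_surjection (surjection_of R),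
      forall phi : {ffun Delta eps -> nat},
        compatible_surjection phi -> surjection_of (preorder_of phi) = phi
    & forall R : {set Delta eps * Delta eps},
        compatible_preorder R -> preorder_of (surjection_of R) = R].
Proof.
split.
- exact: compatible_preorder_of.
- exact: compatible_surjection_of.
- by move=> phi [q [onto _ _ _]]; exact: surjection_ofK onto.
- by move=> R [pR _]; exact: preorder_ofK.
Qed.
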